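(* Let $p\geq3$ and $\lambda=\lambda_p=2\cos(\pi/p)$. The finite orbits of $\Phi_p$ are exactly the set $\{0\}$ and the sets $$\mathcal{Z}_{\mathcal{A}}=\{\alpha_Q \mid Q\in\mathcal{A},\ Q \text{ is } G_p\text{-simple}\},$$ where $\mathcal{A}$ runs over all $G_p$-equivalence classes of $\lambda$-BQFs consisting of hyperbolic forms.
   Context: Let $S=\begin{pmatrix}1&\lambda\\0&1\end{pmatrix}$, $T=\begin{pmatrix}0&-1\\1&0\end{pmatrix}$, $U=ST$, $G_p=\langle S,T\rangle/\{\pm I\}$ acting on $\mathbb{R}\cup\{\infty\}$ by linear fractional transformations. One has $0=U^p(0)<U^{p-1}(0)<\dots<U^2(0)=\lambda<U(0)=\infty$. Define $\Phi_p:[0,\infty)\to[0,\infty)$ by $\Phi_p(x)=TU^{i}(x)$ where $i\in\{1,\dots,p-1\}$ is the unique index with $U^{p-i+1}(0)\le x<U^{p-i}(0)$ (e.g. $\Phi_p(x)=x/(1-\lambda x)$ on $[0,1/\lambda)$ and $\Phi_p(x)=x-\lambda$ on $[\lambda,\infty)$). A finite orbit of $\Phi_p$ means a finite set on which $\Phi_p$ acts as a single cycle, i.e. $\{x,\Phi_p(x),\dots,\Phi_p^{n-1}(x)\}$ with $\Phi_p^n(x)=x$, $n\ge1$. A $\lambda$-BQF is $Q=[A,B,C]$ ($A,B,C\in\mathbb{Z}[\lambda]$, $D=B^2-4AC>0$), with $\alpha_Q=\frac{-B+\sqrt D}{2A}$; $(Q\circ M)(x,y)=Q(ax+by,cx+dy)$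 for $M=\begin{pmatrix}a&b\\c&d\end{pmatrix}\in G_p$, and $Q\sim Q'$ if $Q'=Q\circ V$ for some $V\in G_p$. Hyperbolic forms are those of the form $Q_\alpha=[c,d-a,-b]$, where $\alpha$ is a real number fixed by an element of $G_p$ with $|{\rm trace}|>2$ and $\begin{pmatrix}a&b\\c&d\end{pmatrix}$ is a generator of its stabilizer chosen up to inversion so that $\alpha=\frac{a-d+\sqrt{(a+d)^2-4}}{2c}$. Each equivalence class contains either only hyperbolic forms or none. A hyperbolic form $[A,B,C]$ is $G_p$-simple if $A>0>C$. *)

(* Defs.v *)
From HB Require Import structures.
From mathcomp Require Import all_boot all_order all_algebra.
From mathcomp Require Import classical_sets reals trigo.
Set Implicit Arguments. Unset Strict Implicit. Unset Printing Implicit Defensive.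
Import Order.TTheory GRing.Theory Num.Theory.
Local Open Scope ring_scope.
Local Open Scope classical_set_scope.

Section HeckeDefs.
Variable R : realType.

Definition mx2 (a b c d : R) : 'M[R]_2 :=
  \matrix_(i < 2, j < 2)
    if (i : nat) == 0%N then (if (j : nat) == 0%N then a else b)
    else (if (j : nat) == 0%N then c else d).

Definition ea (M : 'M[R]_2) : R := M 0 0.
Definition eb (M : 'M[R]_2) : R := M 0 1.
Definition ec (M : 'M[R]_2) : R := M 1 0.
Definition ed (M : 'M[R]_2) : R := M 1 1.

Variable p : nat.

Definition lam : R := 2 * cos (pi / p%:R).

Definition Smx : 'M[R]_2 := mx2 1 lam 0 1.
Definition Sinv : 'M[R]_2 := mx2 1 (- lam) 0 1.
Definition Tmx : 'M[R]_2 := mx2 0 (-1) 1 0.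
Definition Tinv : 'M[R]_2 := mx2 0 1 (-1) 0.
Definition Umx : 'M[R]_2 := Smx * Tmx.

(* the matrix group <S,T> (it contains -I = T^2); G_p is its image mod +-I *)
Inductive inGamma : 'M[R]_2 -> Prop :=
| Gam1 : inGamma 1
| GamS M : inGamma M -> inGamma (M * Smx)
| GamSi M : inGamma M -> inGamma (M * Sinv)
| GamT M : inGamma M -> inGamma (M * Tmx)
| GamTi M : inGamma M -> inGamma (M * Tinv).

(* linear fractional action on R \cup {oo}; None stands for oo *)
Definition lft (M : 'M[R]_2) (z : option R) : option R :=
  match z with
  | Some x => if ec M * x + ed M == 0 then None
              else Some ((ea M * x + eb M) / (ec M * x + ed M))
  | None => if ec M == 0 then None else Some (ea M / ec M)
  end.

Definition in_ival (lo hi : option R) (x : R) : bool :=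
  (if lo is Some l then l <= x else false) &&
  (if hi is Some h then x < h else true).

Definition Upt (k : nat) : option R := lft (Umx ^+ k) (Some 0).

Definition Phi_index (x : R) : nat :=
  (find (fun i => in_ival (Upt (p - i + 1)) (Upt (p - i)) x) (iota 1 (p - 1))).+1.

(* Phi_p(x) = T U^i (x) on [0,oo) (the default 0 is never used there) *)
Definition Phi (x : R) : R :=
  if lft (Tmx * Umx ^+ (Phi_index x)) (Some x) is Some y then y else 0.

Definition finite_orbit (Z : set R) : Prop :=
  exists (x : R) (n : nat), 0 <= x /\ (0 < n)%N /\ iter n Phi x = x /\
    Z = [set y | exists2 k : nat, (k < n)%N & y = iter k Phi x].

Definition Zlam (x : R) : Prop :=
  exists (n : nat) (c : nat -> int), x = \sum_(i < n) (c i)%:~R * lam ^+ i.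

Definition bqform := (R * R * R)%type.
Definition fA (Q : bqform) : R := Q.1.1.
Definition fB (Q : bqform) : R := Q.1.2.
Definition fC (Q : bqform) : R := Q.2.
Definition disc (Q : bqform) : R := fB Q ^+ 2 - 4 * fA Q * fC Q.

Definition is_BQF (Q : bqform) : Prop :=
  [/\ Zlam (fA Q), Zlam (fB Q), Zlam (fC Q) & 0 < disc Q].

Definition alphaQ (Q : bqform) : R := (- fB Q + Num.sqrt (disc Q)) / (2 * fA Q).

(* (Q o M)(x,y) = Q(ax+by, cx+dy) *)
Definition form_act (Q : bqform) (M : 'M[R]_2) : bqform :=
  let a := ea M in let b := eb M in let c := ec M in let d := ed M in
  (fA Q * a ^+ 2 + fB Q * a * c + fC Q * c ^+ 2,
   2 * fA Q * a * b + fB Q * (a * d + b * c) + 2 * fC Q * c * d,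
   fA Q * b ^+ 2 + fB Q * b * d + fC Q * d ^+ 2).

Definition equiv_forms (Q Q' : bqform) : Prop :=
  exists2 V, inGamma V & Q' = form_act Q V.

Definition fixes (M : 'M[R]_2) (x : R) : Prop := lft M (Some x) = Some x.

(* M generates the stabilizer of x in G_p (elements of G_p taken up to sign) *)
Definition gen_stab (M : 'M[R]_2) (x : R) : Prop :=
  [/\ inGamma M, fixes M x &
      forall N, inGamma N -> fixes N x ->
        exists k : int, N = M ^ k \/ N = - (M ^ k)].

Definition hyperbolic_form (Q : bqform) : Prop :=
  exists (alpha : R) (M : 'M[R]_2),
    [/\ exists2 N, inGamma N & fixes N alpha /\ 2 < `|\tr N|,
        gen_stab M alpha,
        4 < (ea M + ed M) ^+ 2,
        alpha = (ea M - ed M + Num.sqrt ((ea M + ed M) ^+ 2 - 4)) / (2 * ec M) &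
        Q = (ec M, ed M - ea M, - eb M)].

Definition Gp_simple (Q : bqform) : Prop := 0 < fA Q /\ fC Q < 0.

Definition fclass (Q0 : bqform) : set bqform := [set Q | equiv_forms Q0 Q].

Definition ZA (A : set bqform) : set R :=
  [set x | exists2 Q, A Q & Gp_simple Q /\ x = alphaQ Q].

End HeckeDefs.

(* Main.v *)
Require Import Defs.
From HB Require Import structures.
From mathcomp Require Import all_boot all_order all_algebra.
From mathcomp Require Import boolp classical_sets reals trigo.
From mathcomp Require Import zify ring lra.
Set Implicit Arguments. Unset Strict Implicit. Unset Printing Implicit Defensive.
Import Order.TTheory GRing.Theory Num.Theory.
Local Open Scope ring_scope.
Local Open Scope classical_set_scope.

(** Extend [Phi] to the projective line by letting [T] act on negative numbers
    and on oo, and let [cocycle n z] be the product of the matrices applied in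
    the first [n] steps from [z]. Checking the generators [S] and [T] shows that
    for every [N] in the group and every [z] the orbits of [z] and [N z] merge,
    even at the level of matrices: [cocycle m z = +- cocycle n (N z) * N].
    Consequently only parabolic elements fix the points whose orbit reaches
    [0], the orbit of a hyperbolic fixed point is eventually periodic, and the
    stabilizer of a periodic point is generated by its cocycle over the minimal
    period; no discreteness argument is needed.
    Inverse branches of [Phi] have nonnegative entries, so the form attached to
    a positive periodic point is simple. Conversely, [Phi] maps the roots of the
    simple forms of a class to themselves, injectively since a simple form has
    only one simple predecessor; hence these roots are purely periodic, and by
    merging they form a single cycle. *)

(** * Two-by-two matrices acting on the projective line *)

Section Mx2.
Variable R : realType.
Implicit Types (M N : 'M[R]_2) (z : option R).

Definition det2 M := ea M * ed M - eb M * ec M.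
Definition adj2 M := mx2 (ed M) (- eb M) (- ec M) (ea M).

Lemma mx2E (a b c d : R) :
  (ea (mx2 a b c d) = a) * (eb (mx2 a b c d) = b)
  * (ec (mx2 a b c d) = c) * (ed (mx2 a b c d) = d).
Proof. by rewrite /ea /eb /ec /ed !mxE. Qed.

Lemma mx2P M N :
  ea M = ea N -> eb M = eb N -> ec M = ec N -> ed M = ed N -> M = N.
Proof.
rewrite /ea /eb /ec /ed => h1 h2 h3 h4; apply/matrixP => i j.
by case: i j => [[|[|i]] hi] // [[|[|j]] hj] //;
  [move: h1|move: h2|move: h3|move: h4]; congr (M _ _ = N _ _); apply: val_inj.
Qed.

Lemma mx2_mul M N :
  (ea (M * N) = ea M * ea N + eb M * ec N) *
  (eb (M * N) = ea M * eb N + eb M * ed N) *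
  (ec (M * N) = ec M * ea N + ed M * ec N) *
  (ed (M * N) = ec M * eb N + ed M * ed N).
Proof.
have h i j : (M * N) i j = M i 0 * N 0 j + M i 1 * N 1 j.
  rewrite -[M * N]/(M *m N) mxE big_ord_recl big_ord1.
  by congr (_ + M _ _ * N _ _); apply: val_inj.
by rewrite /ea /eb /ec /ed !h.
Qed.

Lemma mx2_opp M :
  (ea (- M) = - ea M) * (eb (- M) = - eb M) * (ec (- M) = - ec M) * (ed (- M) = - ed M).
Proof. by rewrite /ea /eb /ec /ed !mxE. Qed.

Lemma mx2_one : (ea (1 : 'M[R]_2) = 1) * (eb (1 : 'M[R]_2) = 0)
  * (ec (1 : 'M[R]_2) = 0) * (ed (1 : 'M[R]_2) = 1).
Proof. by rewrite /ea /eb /ec /ed !mxE. Qed.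

Lemma mx2_lin (u v : R) M :
  (ea (u *: M + v%:M) = u * ea M + v) * (eb (u *: M + v%:M) = u * eb M)
  * (ec (u *: M + v%:M) = u * ec M) * (ed (u *: M + v%:M) = u * ed M + v).
Proof. by rewrite /ea /eb /ec /ed !mxE /= !mulr1n !mulr0n !addr0. Qed.

Definition mx2s := (mx2_mul, mx2_opp, mx2_one, mx2_lin, mx2E).

Lemma tr2 M : \tr M = ea M + ed M.
Proof.
rewrite /mxtrace big_ord_recl big_ord1 /ea /ed.
by congr (_ + M _ _); apply: val_inj.
Qed.

Lemma det2M M N : det2 (M * N) = det2 M * det2 N.
Proof. by rewrite /det2 !mx2s; ring. Qed.

Lemma mulV2 M : det2 M = 1 -> adj2 M * M = 1.
Proof. by rewrite /det2 /adj2 => h; apply: mx2P; rewrite !mx2s; lra. Qed.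

Lemma mul2V M : det2 M = 1 -> M * adj2 M = 1.
Proof. by rewrite /det2 /adj2 => h; apply: mx2P; rewrite !mx2s; lra. Qed.

Lemma unit2 M : det2 M = 1 -> M \is a GRing.unit.
Proof. by move=> h; apply/unitrP; exists (adj2 M); rewrite mulV2 ?mul2V. Qed.

Lemma inv2E M : det2 M = 1 -> M^-1 = adj2 M.
Proof.
by move=> h; apply: (mulrI (unit2 h)); rewrite mulrV ?unit2 // mul2V.
Qed.

Lemma det2V M : det2 M = 1 -> det2 M^-1 = 1.
Proof. by move=> h; rewrite inv2E // -h /det2 /adj2 !mx2s; ring. Qed.

Lemma det2_1 : det2 1 = 1. Proof. by rewrite /det2 !mx2s; ring. Qed.

Lemma lftN M z : lft (- M) z = lft M z.
Proof.
case: z => [x|] /=; rewrite !mx2s.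
  rewrite !mulNr -!opprD oppr_eq0; case: ifP => // h.
  by rewrite invrN mulrNN.
by rewrite oppr_eq0 invrN mulrNN.
Qed.

Lemma lft1 z : lft 1 z = z.
Proof.
case: z => [x|] /=; rewrite !mx2s ?eqxx //.
by rewrite mul0r add0r oner_eq0 mul1r addr0 divr1.
Qed.

Lemma lftM M N z : det2 M = 1 -> det2 N = 1 -> lft (M * N) z = lft M (lft N z).
Proof.
(* Homogeneous coordinates: [ratio n k] is the point [n : k], with [n : 0] at infinity, and matrices
   act linearly on nonzero pairs. *)
pose ratio (n k : R) := if k == 0 then None else Some (n / k).
have key n k : (n != 0) || (k != 0) ->
    ratio (ea M * n + eb M * k) (ec M * n + ed M * k) = lft M (ratio n k).
  rewrite /ratio; case: (eqVneq k 0) => [-> /= /[!orbF] hn|hk _ /=].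
    rewrite !mulr0 !addr0 mulf_eq0 (negPf hn) orbF.
    by case: eqVneq => // hc; congr Some; rewrite -mulf_div divff // mulr1.
  have -> : ec M * (n / k) + ed M = (ec M * n + ed M * k) / k by field.
  have -> : ea M * (n / k) + eb M = (ea M * n + eb M * k) / k by field.
  rewrite mulf_eq0 invr_eq0 (negPf hk) orbF.
  by case: eqVneq => // hc; congr Some; rewrite invf_div mulrA divfK.
rewrite /det2 => _ hN; case: z => [x|].
  have hnk : (ea N * x + eb N != 0) || (ec N * x + ed N != 0).
    rewrite -negb_and; apply/negP => /andP [/eqP h3 /eqP h].
    have := oner_neq0 R; rewrite -hN.
    have -> : ea N * ed N - eb N * ec N
          = ea N * (ec N * x + ed N) - ec N * (ea N * x + eb N) by ring.
    by rewrite h h3 !mulr0 subr0 eqxx.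
  rewrite -[RHS](key _ _ hnk) /= !mx2s /ratio.
  by congr (if _ == _ then _ else Some (_ / _)); ring.
have hnk : (ea N != 0) || (ec N != 0).
  rewrite -negb_and; apply/negP => /andP [/eqP h3 /eqP h].
  by have := oner_neq0 R; rewrite -hN h h3 mulr0 mul0r subr0 eqxx.
by rewrite -[RHS](key _ _ hnk) /= !mx2s.
Qed.

Lemma lftK M z : det2 M = 1 -> lft M^-1 (lft M z) = z.
Proof. by move=> h; rewrite -lftM ?det2V // mulVr ?unit2 // lft1. Qed.

Lemma lftVK M z : det2 M = 1 -> lft M (lft M^-1 z) = z.
Proof. by move=> h; rewrite -lftM ?det2V // mulrV ?unit2 // lft1. Qed.

End Mx2.

(** * The group generated by S and T, and its entries in Z[lambda] *)

Section Gamma.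
Variables (R : realType) (p : nat).
Implicit Types (M N : 'M[R]_2) (z : option R).
Local Notation Gam := (@inGamma R p).
Local Notation S := (@Smx R p).
Local Notation T := (@Tmx R).
Local Notation lambda := (@lam R p).

Lemma Gam_det M : Gam M -> det2 M = 1.
Proof.
elim => [|{}M _ h|{}M _ h|{}M _ h|{}M _ h]; first exact: det2_1;
  rewrite det2M h mul1r /det2 !mx2s; ring.
Qed.

Lemma GamM M N : Gam M -> Gam N -> Gam (M * N).
Proof.
move=> hM; elim => [|{}N _ h|{}N _ h|{}N _ h|{}N _ h]; rewrite ?mulr1 ?mulrA //;
  by constructor.
Qed.

Lemma Gam_T : Gam T. Proof. by rewrite -[T]mul1r; do 2!constructor. Qed.
Lemma Gam_Ti : Gam (Tinv R). Proof. by rewrite -[Tinv R]mul1r; do 2!constructor. Qed.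
Lemma Gam_S : Gam S. Proof. by rewrite -[S]mul1r; do 2!constructor. Qed.
Lemma Gam_Si : Gam (Sinv R p). Proof. by rewrite -[Sinv R p]mul1r; do 2!constructor. Qed.

Lemma Smx_inv : S^-1 = Sinv R p.
Proof.
rewrite inv2E ?(Gam_det Gam_S) // /adj2.
by apply: mx2P; rewrite !mx2s // oppr0.
Qed.

Lemma Tmx_inv : T^-1 = Tinv R.
Proof.
have h : det2 T = 1 by rewrite /det2 !mx2s; ring.
by rewrite inv2E // /adj2; apply: mx2P; rewrite !mx2s // opprK.
Qed.

Lemma Gam_inv M : Gam M -> Gam M^-1.
Proof.
have hS := unit2 (Gam_det Gam_S); have hT := unit2 (Gam_det Gam_T).
elim => [|{}M h hV|{}M h hV|{}M h hV|{}M h hV]; first by rewrite invr1; constructor.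
all: have hM := unit2 (Gam_det h).
all: rewrite -?Smx_inv -?Tmx_inv invrM ?unitrV // ?invrK; apply: GamM => //.
- by rewrite Smx_inv; exact: Gam_Si.
- exact: Gam_S.
- by rewrite Tmx_inv; exact: Gam_Ti.
- exact: Gam_T.
Qed.

Lemma GamX M n : Gam M -> Gam (M ^+ n).
Proof.
by move=> h; elim: n => [|n IH]; [constructor|rewrite exprS; exact: GamM].
Qed.

Lemma TmxT : T * T = -1.
Proof. by apply: mx2P; rewrite !mx2s; ring. Qed.

Lemma GamN M : Gam M -> Gam (- M).
Proof. by move=> h; rewrite -mulrN1 -TmxT; do 2!apply: GamM => //; exact: Gam_T. Qed.

Lemma Gam_U : Gam (Umx R p). Proof. exact: GamM Gam_S Gam_T. Qed.

Lemma Zlam0 : Zlam p (0 : R).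
Proof. by exists 0%N, (fun=> 0); rewrite big_ord0. Qed.

Lemma ZlamD (x y : R) : Zlam p x -> Zlam p y -> Zlam p (x + y).
Proof.
(* Padding with zero coefficients brings both sums to the same length. *)
have ext n m (c : nat -> int) : exists d : nat -> int,
    \sum_(i < n) (c i)%:~R * lambda ^+ i = \sum_(i < n + m) (d i)%:~R * lambda ^+ i.
  exists (fun i => if (i < n)%N then c i else 0).
  rewrite big_split_ord /= [X in _ = _ + X]big1 ?addr0 => [|i _].
    by apply: eq_bigr => i _; rewrite ltn_ord.
  by rewrite ltnNge leq_addr /= mul0r.
move=> [n [c ->]] [m [d ->]].
have [c' ->] := ext n m c; have [d' ->] := ext m n d.
exists (n + m)%N, (fun i => c' i + d' i); rewrite [(m + n)%N]addnC -big_split /=.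
by apply: eq_bigr => i _; rewrite intrD mulrDl.
Qed.

Lemma ZlamN (x : R) : Zlam p x -> Zlam p (- x).
Proof.
move=> [n [c ->]]; exists n, (fun i => - c i); rewrite -sumrN.
by apply: eq_bigr => i _; rewrite intrN mulNr.
Qed.

Lemma Zlam_lam (x : R) : Zlam p x -> Zlam p (x * lambda).
Proof.
move=> [n [c ->]]; exists n.+1, (fun i => if i is j.+1 then c j else 0).
rewrite big_ord_recl mul0r add0r mulr_suml.
by apply: eq_bigr => i _; rewrite lift0 exprSr -mulrA.
Qed.

Lemma Zlam1 : Zlam p (1 : R).
Proof. by exists 1%N, (fun=> 1); rewrite big_ord1 mul1r. Qed.

Lemma Gam_Zlam M : Gam M -> [/\ Zlam p (ea M), Zlam p (eb M), Zlam p (ec M) & Zlam p (ed M)].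
Proof.
elim => [|{}M _ [ha hb hc hd]|{}M _ [ha hb hc hd]|{}M _ [ha hb hc hd]|{}M _ [ha hb hc hd]].
- rewrite !mx2s; split; (exact: Zlam0 || exact: Zlam1).
all: rewrite !mx2s ?mulrN !mulr1 ?mulr0 ?addr0 ?add0r.
all: by split; do ?[apply: ZlamD|apply: ZlamN|apply: Zlam_lam].
Qed.

End Gamma.

(** * Powers of U and the intervals on which [Phi] is defined *)

Section Steps.
Variables (R : realType) (p : nat) (hp : (3 <= p)%N).
Implicit Types (M N : 'M[R]_2) (z : option R) (x y : R).
Local Notation T := (@Tmx R).
Local Notation U := (@Umx R p).
Local Notation lambda := (@lam R p).
Local Notation theta := (pi / p%:R : R).

(** Chebyshev values of the second kind, which are the entries of the powers of U. They are positive
    for 0 < k < p and symmetric under k -> p - k. *)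
Definition che (k : nat) : R := sin (k%:R * theta) / sin theta.
Local Notation s := che.

Let p0 : (0 : R) < p%:R. Proof. by rewrite ltr0n; lia. Qed.

Lemma sin_mul_gt0 k : (0 < k < p)%N -> 0 < sin (k%:R * theta).
Proof.
move=> /andP [k0 kp]; apply: sin_gt0_pi.
have h := pi_gt0 R; rewrite mulrCA; apply/andP; split.
  by rewrite mulr_gt0 // divr_gt0 // ltr0n.
by rewrite gtr_pMr // ltr_pdivrMr // mul1r ltr_nat.
Qed.

Lemma sin_theta_gt0 : 0 < sin theta.
Proof. by have := @sin_mul_gt0 1; rewrite mul1r; apply; lia. Qed.

Lemma che0 : s 0 = 0. Proof. by rewrite /che mul0r sin0 mul0r. Qed.
Lemma che1 : s 1 = 1.
Proof. by rewrite /che mul1r divff // gt_eqF // sin_theta_gt0. Qed.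

Lemma che_rec k : s k.+2 = lambda * s k.+1 - s k.
Proof.
rewrite /che /lam.
have -> : k.+2%:R * theta = k.+1%:R * theta + theta by rewrite -(natr1 k.+1); ring.
have -> : k%:R * theta = k.+1%:R * theta - theta by rewrite -(natr1 k); ring.
by rewrite sinD sinB; field; exact: lt0r_neq0 sin_theta_gt0.
Qed.

Lemma che_gt0 k : (0 < k < p)%N -> 0 < s k.
Proof. by move=> h; rewrite divr_gt0 // ?sin_mul_gt0 // sin_theta_gt0. Qed.

Lemma che_rev k : (k <= p)%N -> s (p - k) = s k.
Proof.
move=> h; rewrite /che natrB // mulrBl [p%:R * _]mulrC divfK ?gt_eqF //.
by rewrite sinB sinpi cospi mul0r mulN1r sub0r opprK.
Qed.

Lemma che_p : s p = 0.
Proof. by rewrite -(subn0 p) che_rev // che0. Qed.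

Lemma che_p1 : s p.-1 = 1.
Proof. by rewrite -subn1 che_rev ?che1 //; lia. Qed.

Lemma che_p2 : s p.-2 = lambda.
Proof.
have -> : p.-2 = (p - 2)%N by lia.
by rewrite che_rev; [rewrite che_rec che1 che0; ring|lia].
Qed.

(** This is det U^(k+1) = 1; it makes the ratios of consecutive values monotone. *)
Lemma che_cassini k : s k.+1 ^+ 2 - s k.+2 * s k = 1.
Proof.
elim: k => [|k IH]; first by rewrite che1 che0; ring.
by rewrite -[RHS]IH !(che_rec k.+1) !(che_rec k); ring.
Qed.

Lemma che_ge0 k : (k <= p)%N -> 0 <= s k.
Proof.
move=> h; have [->|k0] := posnP k; first by rewrite che0.
have [->|kp] := eqVneq k p; first by rewrite che_p.
by rewrite ltW // che_gt0 //; lia.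
Qed.

Lemma lam_gt0 : 0 < lambda.
Proof. by rewrite -che_p2 che_gt0 //; lia. Qed.

Lemma UmxX k : U ^+ k.+1 = mx2 (s k.+2) (- s k.+1) (s k.+1) (- s k).
Proof.
elim: k => [|k IH].
  rewrite expr1 che_rec che1 che0.
  by apply: mx2P; rewrite !mx2s; ring.
rewrite exprS IH.
by apply: mx2P; rewrite !mx2s ?(che_rec k.+1) ?(che_rec k); ring.
Qed.

Lemma TUmxX k : T * U ^+ k.+1 = mx2 (- s k.+1) (s k) (s k.+2) (- s k.+1).
Proof. by rewrite UmxX; apply: mx2P; rewrite !mx2s; ring. Qed.

Lemma UptE k : (k.+2 <= p)%N -> Upt R p k.+2 = Some (s k.+2 / s k.+1).
Proof.
move=> h; rewrite /Upt UmxX /= !mx2s !mulr0 !add0r oppr_eq0.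
have /gt_eqF -> : 0 < s k.+1 by apply: che_gt0; lia.
by rewrite invrN mulrNN.
Qed.

Lemma Upt1 : Upt R p 1 = None.
Proof. by rewrite /Upt UmxX /= !mx2s che0 mulr0 oppr0 addr0 eqxx. Qed.

(* Shifted by one: the index of the paper is [i.+1]. *)
Definition idx_ok x i := (s i <= x * s i.+1) && (x * s i.+2 < s i.+1).

(** By [che_rev] the endpoints are s i / s i.+1 and s i.+1 / s i.+2. Clearing denominators also
    covers the unbounded last interval, where s p = 0 makes the upper condition hold. *)
Lemma in_ivalE x i : (i.+2 <= p)%N ->
  in_ival (Upt R p (p - i.+1 + 1)) (Upt R p (p - i.+1)) x = idx_ok x i.
Proof.
move=> h; rewrite /in_ival /idx_ok.
have -> : (p - i.+1 + 1 = (p - i.+2).+2)%N by lia.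
rewrite UptE; last lia.
have -> : (p - i.+2).+2 = (p - i)%N by lia.
have -> : (p - i.+2).+1 = (p - i.+1)%N by lia.
rewrite !che_rev; try lia.
have h1 : 0 < s i.+1 by apply: che_gt0; lia.
rewrite ler_pdivrMr //; congr (_ && _).
have [e|e] := eqVneq i.+2 p.
  have -> : (p - i.+1 = 1)%N by lia.
  by rewrite Upt1 e che_p mulr0 h1.
have -> : (p - i.+1 = (p - i.+3).+2)%N by lia.
rewrite UptE; last lia.
have -> : (p - i.+3).+2 = (p - i.+1)%N by lia.
have -> : (p - i.+3).+1 = (p - i.+2)%N by lia.
rewrite !che_rev; try lia.
by rewrite ltr_pdivlMr // che_gt0 //; lia.
Qed.

(** The upper endpoints s k.+1 / s k.+2 increase with k by [che_cassini]. *)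
Lemma idx_up x i j : (i <= j)%N -> (j.+2 <= p)%N ->
  x * s i.+2 < s i.+1 -> x * s j.+2 < s j.+1.
Proof.
move=> hij; rewrite -(subnKC hij); elim: (j - i)%N => [|n IH]; rewrite ?addn0 // ?addnS.
move=> hn h; have {IH h} := IH _ h; move=> /(_ ltac:(lia)).
set k := (i + n)%N => h.
have h2 : 0 < s k.+2 by apply: che_gt0; rewrite /k; lia.
have h3 : 0 <= s k.+3 by apply: che_ge0; rewrite /k; lia.
have := che_cassini k.+1; move: h h2 h3.
move: (s k.+1) (s k.+2) (s k.+3) => a b c h h2 h3 hc.
rewrite -(ltr_pM2r h2).
apply: (@le_lt_trans _ _ (a * c)); last by nra.
by rewrite mulrAC ler_wpM2r // ltW.
Qed.

Lemma idx_uniq x i j : (i.+2 <= p)%N -> (j.+2 <= p)%N ->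
  idx_ok x i -> idx_ok x j -> i = j.
Proof.
have w i' j' : (i' < j')%N -> (j'.+2 <= p)%N -> idx_ok x i' -> idx_ok x j' -> False.
  move=> hij hj /andP [_ h1] /andP [h2 _].
  case: j' hij hj h2 => // j' hij hj h2.
  have := @idx_up x i' j' ltac:(lia) ltac:(lia) h1.
  by move=> h3; move: h2; rewrite leNgt h3.
move=> hi hj oi oj; have [h|h|//] := ltngtP i j; exfalso.
  exact: (w _ _ h hj oi oj).
exact: (w _ _ h hi oj oi).
Qed.

(** The least index whose upper endpoint exceeds x works, because its lower endpoint is the upper
    endpoint of the previous index. The last index p.-2 always qualifies. *)
Lemma idx_ex x : 0 <= x -> exists2 i, (i.+2 <= p)%N & idx_ok x i.
Proof.
move=> x0; pose P i := (i.+2 <= p)%N && (x * s i.+2 < s i.+1).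
have exP : exists i, P i.
  exists p.-2; have e : p.-2.+2 = p by lia.
  by rewrite /P e leqnn /= che_p mulr0 che_gt0 //; lia.
case: (ex_minnP exP) => i /andP [ip h] hmin; exists i => //.
rewrite /idx_ok h andbT; case: i ip h hmin => [|i] ip h hmin.
  by rewrite che0 che1 mulr1.
rewrite leNgt; apply/negP => h2.
by have := hmin i; rewrite /P h2 andbT ltnn => /(_ ltac:(lia)).
Qed.

Lemma Phi_indexE x i : (i.+2 <= p)%N -> idx_ok x i -> Phi_index p x = i.+1.
Proof.
move=> ip ok; rewrite /Phi_index; congr _.+1.
set P := (fun _ => _).
have hP j : (j.+2 <= p)%N -> P j.+1 = (i == j).
  move=> hj; rewrite /P in_ivalE //; apply/idP/eqP => [h|<- //].
  exact: idx_uniq ok h.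
have hs : (find P (iota 1 (p - 1)) < p - 1)%N.
  rewrite -[X in (_ < X)%N](size_iota 1) -has_find; apply/hasP; exists i.+1.
    by rewrite mem_iota; lia.
  by rewrite hP // eqxx.
have : P (nth 0%N (iota 1 (p - 1)) (find P (iota 1 (p - 1)))).
  by apply: nth_find; rewrite has_find size_iota.
by rewrite nth_iota // add1n hP; [move/eqP|lia].
Qed.

End Steps.

(** * The extended map, its cocycle, and the merging of orbits *)

Section Cocycle.
Variables (R : realType) (p : nat) (hp : (3 <= p)%N).
Implicit Types (M N : 'M[R]_2) (z : option R) (x y : R).
Local Notation Gam := (@inGamma R p).
Local Notation S := (@Smx R p).
Local Notation T := (@Tmx R).
Local Notation U := (@Umx R p).
Local Notation lambda := (@lam R p).
Local Notation s := (@che R p).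

(** Equality in G_p, where matrices count up to sign. *)
Definition eqpm M N := M = N \/ M = - N.

Lemma eqpm_refl M : eqpm M M. Proof. by left. Qed.

Lemma eqpm_sym M N : eqpm M N -> eqpm N M.
Proof. by case=> ->; [left|right; rewrite opprK]. Qed.

Lemma eqpm_trans M N P : eqpm M N -> eqpm N P -> eqpm M P.
Proof. by case=> -> [] ->; rewrite ?opprK; ((by left) || (by right)). Qed.

Lemma eqpm_mul M N P Q : eqpm M N -> eqpm P Q -> eqpm (M * P) (N * Q).
Proof.
by case=> -> [] ->; rewrite ?mulrNN ?mulrN ?mulNr; ((by left) || (by right)).
Qed.

Lemma eqpm_lft M N z : eqpm M N -> lft M z = lft N z.
Proof. by case=> ->; rewrite ?lftN. Qed.

Lemma eqpm_inv M N : eqpm M N -> eqpm M^-1 N^-1.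
Proof. by case=> ->; rewrite ?invrN; ((by left) || (by right)). Qed.

(** One application of T brings negative numbers and oo into [0, oo), where the extension agrees
    with [Phi]. *)
Definition stepmx z : 'M[R]_2 :=
  if z is Some x then if x < 0 then T else T * U ^+ Phi_index p x else T.
Definition Phi_ext z := lft (stepmx z) z.
Fixpoint cocycle n z : 'M[R]_2 := if n is m.+1 then stepmx (iter m Phi_ext z) * cocycle m z else 1.

Lemma stepmx_Gam z : Gam (stepmx z).
Proof.
case: z => [x|] /=; last exact: Gam_T.
case: ifP => _; first exact: Gam_T.
by apply: GamM; [exact: Gam_T|apply: GamX; exact: Gam_U].
Qed.

Lemma cocycle_Gam n z : Gam (cocycle n z).
Proof. by elim: n => [|n IH] /=; [constructor|apply: GamM => //; exact: stepmx_Gam]. Qed.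

Lemma cocycle_det n z : det2 (cocycle n z) = 1. Proof. exact: Gam_det (cocycle_Gam n z). Qed.

Lemma cocycle_unit n z : cocycle n z \is a GRing.unit. Proof. exact: unit2 (cocycle_det n z). Qed.

Lemma cocycle_lft n z : lft (cocycle n z) z = iter n Phi_ext z.
Proof.
elim: n => [|n IH] /=; first exact: lft1.
by rewrite lftM ?cocycle_det ?(Gam_det (stepmx_Gam _)) // IH.
Qed.

Lemma cocycleD m n z : cocycle (m + n) z = cocycle m (iter n Phi_ext z) * cocycle n z.
Proof. by elim: m => [|m IH] /=; rewrite ?mul1r // IH iterD mulrA. Qed.

Lemma idxP x : 0 <= x -> exists2 i, (i.+2 <= p)%N & idx_ok p x i /\ Phi_index p x = i.+1.
Proof.
move=> h; have [i ip ok] := idx_ex hp h.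
by exists i => //; rewrite (Phi_indexE hp ip ok).
Qed.

Lemma stepmx_ge0 x i : 0 <= x -> (i.+2 <= p)%N -> idx_ok p x i ->
  stepmx (Some x) = mx2 (- s i.+1) (s i) (s i.+2) (- s i.+1).
Proof.
by move=> x0 ip ok; rewrite /= ltNge x0 /= (Phi_indexE hp ip ok) TUmxX.
Qed.

(** On the chosen interval the numerator s i - x s i.+1 is nonpositive and the denominator x s i.+2
    - s i.+1 is negative, so the default value in [Phi] never occurs. *)
Lemma Phi_ext_ge0 x : 0 <= x -> Phi_ext (Some x) = Some (Phi p x) /\ 0 <= Phi p x.
Proof.
move=> x0; have [i ip [ok e]] := idxP x0.
rewrite /Phi_ext /Phi [stepmx _]/= ltNge x0 e /= TUmxX // !mx2s.
move: ok => /andP [h1 h2].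
rewrite lt_eqF; last by rewrite mulrC subr_lt0.
split=> //; rewrite -mulrNN -invrN; apply: divr_ge0; rewrite opprD.
  by rewrite mulNr opprK subr_ge0 mulrC.
by rewrite opprK addrC subr_ge0 mulrC ltW.
Qed.

Lemma iter_Phi_ext_ge0 n x : 0 <= x ->
  iter n Phi_ext (Some x) = Some (iter n (Phi p) x) /\ 0 <= iter n (Phi p) x.
Proof.
move=> x0; elim: n => [|n [IH h]] //=; rewrite IH; exact: Phi_ext_ge0.
Qed.

Lemma idx0 : idx_ok p (0 : R) 0.
Proof. by rewrite /idx_ok che0 che1 // !mul0r lexx ltr01. Qed.

Lemma stepmx0 : stepmx (Some 0) = mx2 (-1) 0 lambda (-1).
Proof.
rewrite (stepmx_ge0 (lexx _) _ idx0); last lia.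
by rewrite che_rec // che1 // che0 mulr1 subr0.
Qed.

Lemma Phi_ext0 : Phi_ext (Some 0) = Some 0.
Proof. by rewrite /Phi_ext stepmx0 /= !mx2s mulr0 add0r oppr_eq0 oner_eq0 mulr0 addr0 mul0r. Qed.

(** Recording matrices and not only points allows stabilizer elements to be read off when N fixes
    z. *)
Definition merges z N := exists m n, eqpm (cocycle m z) (cocycle n (lft N z) * N).

Lemma merges_iter z N m n : Gam N -> eqpm (cocycle m z) (cocycle n (lft N z) * N) ->
  iter m Phi_ext z = iter n Phi_ext (lft N z).
Proof.
move=> hN h; rewrite -!cocycle_lft (eqpm_lft _ h) lftM ?cocycle_det //; exact: Gam_det hN.
Qed.

Lemma merges_ext z N m n k : Gam N -> eqpm (cocycle m z) (cocycle n (lft N z) * N) ->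
  eqpm (cocycle (k + m) z) (cocycle (k + n) (lft N z) * N).
Proof.
move=> hN h; rewrite !cocycleD (merges_iter hN h) -mulrA.
by apply: eqpm_mul h; exact: eqpm_refl.
Qed.

(** The two identities are prolonged by m' and n steps, so that both contain the cocycle of
    [lft N z] over n + m' steps. *)
Lemma merges_comp z M N : Gam M -> Gam N ->
  merges z N -> merges (lft N z) M -> merges z (M * N).
Proof.
move=> hM hN [m [n h1]] [m' [n' h2]]; exists (m' + m)%N, (n + n')%N.
rewrite lftM; [|exact: Gam_det hM|exact: Gam_det hN].
apply: eqpm_trans (merges_ext m' hN h1) _.
rewrite addnC mulrA; apply: eqpm_mul; last exact: eqpm_refl.
exact: merges_ext hM h2.
Qed.

Lemma merges_inv z N : Gam N -> merges z N -> merges (lft N z) N^-1.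
Proof.
move=> hN [m [n h]]; exists n, m; rewrite lftK; last exact: Gam_det hN.
have := eqpm_mul (eqpm_sym h) (eqpm_refl N^-1).
by rewrite mulrK //; exact: unit2 (Gam_det hN).
Qed.

Lemma lftT_None : lft T None = Some 0.
Proof. by rewrite /= !mx2s oner_eq0 mul0r. Qed.

Lemma lftT x : x != 0 -> lft T (Some x) = Some (- x^-1).
Proof. by move=> h; rewrite /= !mx2s mul1r addr0 (negPf h) mul0r add0r mulN1r. Qed.

(** T is the first step from z or, if z >= 0, the first step from T z; in the latter case T * T = -1
    leads back to z. *)
Lemma merges_T z : merges z T.
Proof.
case: z => [x|]; last first.
  by exists 1%N, 0%N; left; rewrite /= mulr1 mul1r.
have [x0|x0] := ltP x 0.
  by exists 1%N, 0%N; left; rewrite /= x0 mulr1 mul1r.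
exists 0%N, 1%N; right.
have -> : cocycle 1 (lft T (Some x)) = T.
  have [->|xn] := eqVneq x 0.
    by rewrite /= !mx2s mulr0 addr0 eqxx mulr1.
  by rewrite lftT //= oppr_lt0 invr_gt0 lt0r xn x0 mulr1.
by rewrite TmxT opprK.
Qed.

Lemma lftS x : lft S (Some x) = Some (x + lambda).
Proof. by rewrite /= !mx2s mul0r add0r oner_eq0 mul1r divr1. Qed.

(** Since U T = -S, the steps T and then T U^(k+1) from a negative point amount to the translation S
    followed by T U^k. *)
Lemma TUT k : T * U ^+ k.+1 * T = - (T * U ^+ k * S).
Proof. by rewrite exprSr /Umx -!mulrA TmxT !mulrN1 !mulrN. Qed.

Lemma cocycle2 z : cocycle 2 z = stepmx (Phi_ext z) * stepmx z. Proof. by rewrite /= mulr1. Qed.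

(** S fixes oo; for x >= 0 the step at x + lambda is S^-1 up to sign; for x < 0 the two steps from x
    equal, up to sign, S followed by the single step at x + lambda. *)
Lemma merges_S z : merges z S.
Proof.
case: z => [x|]; last first.
  exists 2%N, 1%N; right; have -> : lft S None = None by rewrite /= !mx2s eqxx.
  rewrite cocycle2 [cocycle 1 _]/= mulr1.
  rewrite /Phi_ext [stepmx None]/= lftT_None /= ltxx (Phi_indexE hp _ idx0); last lia.
  by rewrite TUT expr0 mulr1.
have [x0|x0] := leP 0 x.
  have xl : 0 <= x + lambda by apply: addr_ge0 => //; rewrite ltW ?lam_gt0.
  exists 0%N, 1%N; right; rewrite lftS /= ltNge xl.
  (* The last interval is [lambda, oo), of index p.-2. *)
  have e : p.-2.+2 = p by lia.
  rewrite (@Phi_indexE _ _ hp _ p.-2); [|by rewrite e|].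
    rewrite TUmxX // e che_p // che_p2 //.
    have -> : s p.-2.+1 = 1 by rewrite -(che_p1 _ hp); congr s; lia.
    by apply: mx2P; rewrite !mx2s; ring.
  have e1 : p.-2.+1 = p.-1 by lia.
  by rewrite /idx_ok e e1 che_p // che_p1 // che_p2 // mulr1 mulr0 ltr01 lerDr x0.
have y0 : 0 < - x^-1 by rewrite oppr_gt0 invr_lt0.
have xn : x != 0 by rewrite lt_eqF.
have [i ip [ok e]] := idxP (ltW y0).
have e2 : cocycle 2 (Some x) = - (T * U ^+ i * S).
  rewrite cocycle2 /Phi_ext [stepmx (Some x)]/= x0 lftT //.
  by rewrite [stepmx _]/= ltNge (ltW y0) /= e TUT.
exists 2%N, 1%N; right; rewrite e2 lftS; congr (- (_ * _)); rewrite /= mulr1.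
move: ok => /andP [h1 h2].
(* For i = 0 one has -1/x < 1/lambda, so x + lambda is still negative and its step is T. Otherwise
   the index of x + lambda is one less than that of -1/x. *)
case: i ip e e2 h1 h2 => [|i] ip e e2 h1 h2.
  rewrite ifT ?expr0 ?mulr1 //.
  move: h2; rewrite che_rec // che1 // che0 mulr1 subr0 mulNr ltrNl mulrC.
  rewrite ltr_ndivlMr // mulN1r; lra.
have f k : - x^-1 * s k.+2 = - (lambda * s k.+1 - s k) / x.
  by rewrite che_rec //; field.
rewrite !f in h1 h2.
have h1' : s i <= (x + lambda) * s i.+1.
  move: h1; rewrite ler_ndivlMr //; lra.
have h2' : (x + lambda) * s i.+2 < s i.+1.
  move: h2; rewrite ltr_ndivrMr //; lra.
have xl0 : 0 <= x + lambda.
  have hi : 0 <= s i by apply: che_ge0 => //; lia.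
  have hi1 : 0 < s i.+1 by apply: che_gt0 => //; lia.
  by rewrite -(pmulr_lge0 _ hi1); apply: le_trans h1'.
rewrite ltNge xl0 /= (@Phi_indexE _ _ hp _ i) //; first lia.
by rewrite /idx_ok h1' h2'.
Qed.

(** Induction on a word in the generators; an inverse generator is handled by [merges_inv] at the
    preimage of z. *)
Lemma merges_Gam z N : Gam N -> merges z N.
Proof.
move=> hN; elim: hN z => {N} [|N hN IH|N hN IH|N hN IH|N hN IH] z.
- by exists 0%N, 0%N; left; rewrite /= mulr1.
- by apply: merges_comp => //; [exact: Gam_S|exact: merges_S].
- apply: merges_comp => //; first exact: Gam_Si.
  have hS := Gam_S R p; have hS1 := Gam_det hS.
  by rewrite -Smx_inv -[z](lftVK z hS1); apply: merges_inv => //; exact: merges_S.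
- by apply: merges_comp => //; [exact: Gam_T|exact: merges_T].
- apply: merges_comp => //; first exact: Gam_Ti.
  have hT := Gam_T R p; have hT1 := Gam_det hT.
  by rewrite -Tmx_inv -[z](lftVK z hT1); apply: merges_inv => //; exact: merges_T.
Qed.

End Cocycle.

(** * Stabilizers, cusps and periodic points *)

Section Stabilizers.
Variables (R : realType) (p : nat) (hp : (3 <= p)%N).
Implicit Types (M N V W : 'M[R]_2) (z : option R) (x y : R) (Q : bqform R).
Local Notation Gam := (@inGamma R p).
Local Notation s := (@che R p).
Local Notation F := (@Phi_ext R p).
Local Notation cocycle := (@cocycle R p).

Definition trace2 M := ea M + ed M.

Lemma trace2_conj C N : det2 C = 1 -> trace2 (C * N * C^-1) = trace2 N.
Proof.
move=> h; rewrite inv2E // -[RHS]mul1r -h /trace2 /adj2 /det2 !mx2s; ring.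
Qed.

Lemma trace2_inv N : det2 N = 1 -> trace2 N^-1 = trace2 N.
Proof. by move=> h; rewrite inv2E // /trace2 /adj2 !mx2s addrC. Qed.

Lemma trace2_eqpm M N : eqpm M N -> trace2 M ^+ 2 = trace2 N ^+ 2.
Proof. by case=> -> //; rewrite /trace2 !mx2s; ring. Qed.

(** If N fixes z, merging compares two cocycles of the same point. Splitting off the shorter one
    conjugates N, or N^-1 when n > m, to the cocycle of a loop further along the orbit. *)
Lemma stab_red N z : Gam N -> lft N z = z -> exists n r N1,
  [/\ N1 = N \/ N1 = N^-1, iter r F (iter n F z) = iter n F z &
      eqpm (cocycle r (iter n F z) * cocycle n z) (cocycle n z * N1)].
Proof.
move=> hN fixN.
have key m n N1 : (n <= m)%N -> Gam N1 -> lft N1 z = z ->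
    eqpm (cocycle m z) (cocycle n z * N1) -> exists r,
    iter r F (iter n F z) = iter n F z /\
    eqpm (cocycle r (iter n F z) * cocycle n z) (cocycle n z * N1).
  move=> nm hN1 fix1 h; exists (m - n)%N; rewrite -cocycleD subnK // -iterD subnK //.
  by split=> //; rewrite -{2}fix1; apply: merges_iter; rewrite ?fix1.
have [m [n]] := merges_Gam hp z hN; rewrite fixN => h.
have [nm|/ltnW mn] := leqP n m.
  have [r [h1 h2]] := key _ _ _ nm hN fixN h.
  by exists n, r, N; split=> //; left.
have hd := Gam_det hN.
have fixN' : lft N^-1 z = z by rewrite -{1}fixN lftK.
have h' : eqpm (cocycle n z) (cocycle m z * N^-1).
  have := eqpm_mul (eqpm_sym h) (eqpm_refl N^-1).
  by rewrite mulrK //; exact: unit2.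
have [r [h1 h2]] := key _ _ _ mn (Gam_inv hN) fixN' h'.
by exists m, r, N^-1; split=> //; right.
Qed.

(** Lets the loop start at a chosen later point: at the cusp 0, or at a periodic point itself. *)
Lemma stab_ext k n r N1 z :
  iter r F (iter n F z) = iter n F z ->
  eqpm (cocycle r (iter n F z) * cocycle n z) (cocycle n z * N1) ->
  iter r F (iter (k + n) F z) = iter (k + n) F z /\
  eqpm (cocycle r (iter (k + n) F z) * cocycle (k + n) z) (cocycle (k + n) z * N1).
Proof.
move=> h1 h2; split; first by rewrite iterD -[LHS]iterD addnC iterD h1.
rewrite !cocycleD iterD mulrA -cocycleD addnC cocycleD h1 -!mulrA.
by apply: eqpm_mul h2; exact: eqpm_refl.
Qed.

Lemma trace2_stab C P N N1 : det2 C = 1 -> Gam N -> N1 = N \/ N1 = N^-1 ->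
  eqpm (P * C) (C * N1) -> trace2 N ^+ 2 = trace2 P ^+ 2.
Proof.
move=> hC hN hN1 h; have hd := Gam_det hN.
have -> : trace2 N = trace2 N1 by case: hN1 => ->; rewrite ?trace2_inv.
rewrite -(trace2_conj N1 hC); apply: trace2_eqpm.
have := eqpm_mul (eqpm_sym h) (eqpm_refl C^-1).
by rewrite mulrK //; exact: unit2.
Qed.

Lemma iter_Phi_ext0 k : iter k F (Some 0) = Some 0.
Proof. by elim: k => //= k ->; exact: Phi_ext0. Qed.

(** Every step at 0 is the same lower triangular matrix with diagonal entries -1. *)
Lemma trace2_cocycle0 r : trace2 (cocycle r (Some 0)) ^+ 2 = 4.
Proof.
suff: [/\ ea (cocycle r (Some 0)) = (-1) ^+ r, ed (cocycle r (Some 0)) = (-1) ^+ r &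
          eb (cocycle r (Some 0)) = 0].
  move=> [h1 h2 _]; rewrite /trace2 h1 h2.
  have he : ((-1) ^+ r) ^+ 2 = 1 :> R by rewrite -exprM mulnC exprM sqrrN !expr1n.
  by nra.
elim: r => [|r [h1 h2 h3]]; first by rewrite /= !mx2s.
rewrite [cocycle r.+1 _]/= iter_Phi_ext0 stepmx0 // !mx2s h1 h2 h3 exprS; split; ring.
Qed.

(* Points whose orbit reaches [0] are the cusps. *)
Lemma cusp_not_hyperbolic k N z : Gam N -> lft N z = z -> iter k F z = Some 0 ->
  trace2 N ^+ 2 = 4.
Proof.
move=> hN fixN hk; have [n [r [N1 [hN1 h1 h2]]]] := stab_red hN fixN.
have [_ h] := stab_ext k h1 h2.
rewrite (trace2_stab (cocycle_det _ _ _) hN hN1 h).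
by rewrite addnC iterD hk iter_Phi_ext0 trace2_cocycle0.
Qed.

(** A loop of length 0 has cocycle 1, and would force the squared trace of N to be 4. *)
Lemma hyperbolic_ev_periodic N z : Gam N -> lft N z = z -> 4 < trace2 N ^+ 2 ->
  exists n r, (0 < r)%N /\ iter r F (iter n F z) = iter n F z.
Proof.
move=> hN fixN hyp_data; have [n [r [N1 [hN1 h1 h2]]]] := stab_red hN fixN.
exists n, r; split=> //; rewrite lt0n; apply/eqP => r0.
move: hyp_data; rewrite r0 in h2; rewrite (trace2_stab (cocycle_det _ _ _) hN hN1 h2).
have -> : (trace2 (1 : 'M[R]_2)) ^+ 2 = 4 by rewrite /trace2 !mx2s; ring.
by rewrite ltxx.
Qed.

(** Up to sign each step has positive diagonal and nonpositive off-diagonal entries, a pattern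
    stable under products; inverses then have nonnegative entries. *)
Lemma cocycle_pos n x : 0 <= x -> exists P,
  [/\ eqpm (cocycle n (Some x)) P, 0 < ea P /\ 0 < ed P,
      eb P <= 0, ec P <= 0 & (0 < n)%N -> eb P + ec P < 0].
Proof.
move=> x0; elim: n => [|n [P [h [ha hd] hb hc _]]].
  exists 1; rewrite !mx2s; split=> //; exact: eqpm_refl.
have [e y0] := iter_Phi_ext_ge0 hp n x0.
set y := iter n _ x in e y0.
have [i ip [ok _]] := idxP hp y0.
have hs := stepmx_ge0 hp y0 ip ok.
have s0 : 0 < s i.+1 by apply: che_gt0 => //; lia.
have s1 : 0 <= s i by apply: che_ge0 => //; lia.
have s2 : 0 <= s i.+2 by apply: che_ge0.
(* As p >= 3, the values s i and s i.+2 do not vanish together. *)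
have s3 : 0 < s i * ed P + s i.+2 * ea P.
  have [->|i0] := posnP i.
    by rewrite che0 mul0r add0r mulr_gt0 // che_gt0 //; lia.
  apply: ltr_pwDl; last by rewrite mulr_ge0 // ltW.
  by rewrite mulr_gt0 // che_gt0 //; lia.
have u1 := mulr_gt0 s0 ha; have u2 := mulr_gt0 s0 hd.
have u3 := mulr_ge0_le0 s1 hc; have u4 := mulr_ge0_le0 s2 hb.
have u5 := mulr_ge0_le0 (ltW s0) hb; have u6 := mulr_ge0_le0 (ltW s0) hc.
have u7 := mulr_ge0 s1 (ltW hd); have u8 := mulr_ge0 s2 (ltW ha).
exists (mx2 (s i.+1) (- s i) (- s i.+2) (s i.+1) * P); rewrite !mx2s; split.
- rewrite /= e; apply: eqpm_mul h; right; rewrite hs.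
  by apply: mx2P; rewrite !mx2s ?opprK.
- by split; lra.
- lra.
- lra.
- by move=> _; lra.
Qed.

Lemma periodic_matrix r x : 0 < x -> (0 < r)%N -> iter r F (Some x) = Some x ->
  exists W, [/\ eqpm (cocycle r (Some x)) W^-1, Gam W, fixes W x,
     [/\ 0 < ea W, 0 < eb W, 0 < ec W & 0 < ed W] & 4 < trace2 W ^+ 2].
Proof.
move=> x0 r0 per; have [P [hP [ha hd] hb hc /(_ r0) hbc]] := cocycle_pos r (ltW x0).
have gP : Gam P.
  by case: hP => e; [rewrite -e|rewrite -[P]opprK -e; apply: GamN]; exact: cocycle_Gam.
have dP := Gam_det gP.
have fP : lft P (Some x) = Some x by rewrite -(eqpm_lft _ hP) cocycle_lft.
have fx : ec P * x ^+ 2 + (ed P - ea P) * x - eb P = 0.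
  move: fP => /=; case: eqVneq => // hn [] /(canRL (divfK hn)) h.
  by rewrite mulrDr in h; lra.
have det : ea P * ed P - eb P * ec P = 1 by [].
(* Here (ea P - ed P)^2 + 4 eb P ec P = 0 with both terms nonnegative. The fixed point equation
   becomes ec P x^2 = eb P, so both off-diagonal entries vanish, against [hbc]. *)
have par : trace2 P ^+ 2 = 4 -> False.
  rewrite /trace2 => h4; have e0 : eb P * ec P = 0.
    by have := sqr_ge0 (ea P - ed P); nra.
  have eq : ea P = ed P.
    by apply/eqP; rewrite -subr_eq0 -sqrf_eq0; apply/eqP; nra.
  rewrite eq subrr mul0r addr0 in fx.
  have hx2 : 0 < x ^+ 2 by rewrite exprn_gt0.
  move/eqP: e0; rewrite mulf_eq0 => /orP [] /eqP e0; rewrite e0 in fx hbc; nra.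
(* If [eb P] or [ec P] vanished, P would fix the cusp 0 or oo and have squared trace 4. *)
have b0 : eb P < 0.
  rewrite lt_neqAle hb andbT; apply/eqP => e; apply: par.
  apply: (@cusp_not_hyperbolic 0 P (Some 0)) => //=.
  by rewrite !mulr0 e add0r addr0 gt_eqF // mul0r.
have c0 : ec P < 0.
  rewrite lt_neqAle hc andbT; apply/eqP => e; apply: par.
  apply: (@cusp_not_hyperbolic 1 P None) => //; first by rewrite /= e eqxx.
  exact: lftT_None.
exists P^-1; rewrite invrK; split=> //; first exact: Gam_inv.
- by rewrite /fixes -{1}fP lftK.
- by rewrite inv2E // /adj2 !mx2s !oppr_gt0.
- by rewrite trace2_inv // /trace2; have := sqr_ge0 (ea P - ed P); nra.
Qed.

Lemma cocycle_mul q r z : iter r F z = z -> cocycle (q * r) z = cocycle r z ^+ q.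
Proof.
move=> h; elim: q => [|q IH]; first by rewrite mul0n expr0.
rewrite mulSn cocycleD IH exprS; congr (cocycle r _ * _).
by elim: q {IH} => //= q IH; rewrite mulSn iterD IH.
Qed.

Lemma iter_mul q r z : iter r F z = z -> iter (q * r) F z = z.
Proof. by move=> h; elim: q => //= q IH; rewrite mulSn iterD IH. Qed.

Lemma min_period r z : (0 < r)%N -> iter r F z = z -> exists r0,
  [/\ (0 < r0)%N, iter r0 F z = z & forall k, iter k F z = z -> (r0 %| k)%N].
Proof.
move=> r0 h; pose P k := `[< (0 < k)%N /\ iter k F z = z >].
have exP : exists k, P k by exists r; apply/asboolP.
case: (ex_minnP exP) => m /asboolP [m0 hm] hmin; exists m; split=> // k hk.
rewrite /dvdn; apply/negPn/negP => hn.
have : (m <= k %% m)%N.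
  apply: hmin; apply/asboolP; split; first by rewrite lt0n.
  by move: hk; rewrite {1}(divn_eq k m) addnC iterD iter_mul.
by rewrite leqNgt ltn_mod m0.
Qed.

(** The loop of a stabilizer element, moved on to x itself, has length a multiple of the minimal
    period, so the element is up to sign a power of the minimal cocycle. *)
Lemma periodic_gen_stab x : 0 < x -> (exists2 r, (0 < r)%N & iter r F (Some x) = Some x) ->
  exists W, [/\ gen_stab p W x,
     [/\ 0 < ea W, 0 < eb W, 0 < ec W & 0 < ed W] & 4 < trace2 W ^+ 2].
Proof.
move=> x0 [r' r'0 hr']; have [r [r0 per hmin]] := min_period r'0 hr'.
have [W [hW gW fW posW hypW]] := periodic_matrix x0 r0 per.
exists W; split=> //; split=> // N gN fN.
set P := cocycle r (Some x) in hW.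
have [n [k [N1 [hN1 h1 h2]]]] := stab_red gN fN.
(* After n * r >= n steps the orbit is back at x. *)
have [h3 h4] := stab_ext (n * r - n) h1 h2.
have e : (n * r - n + n = n * r)%N by rewrite subnK // leq_pmulr.
rewrite e iter_mul // in h3 h4.
have /dvdnP [q kq] := hmin _ h3.
rewrite kq !cocycle_mul // -exprD addnC exprD in h4.
have {}h4 : eqpm (P ^+ q) N1.
  have := eqpm_mul (eqpm_refl (P ^+ n)^-1) h4.
  by rewrite !mulKr // unitrX // cocycle_unit.
have {}h4 : eqpm N1 (W^-1 ^+ q).
  apply: eqpm_trans (eqpm_sym h4) _; elim: (q) => [|j IH]; first by left.
  by rewrite !exprS; apply: eqpm_mul.
case: hN1 h4 => -> h4.
  by exists (- q%:Z); rewrite -exprnN -exprVn.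
exists q%:Z; have := eqpm_inv h4; rewrite invrK -exprVn invrK.
exact.
Qed.

End Stabilizers.

(** * Roots of forms, hyperbolic forms and simple forms *)

Section Forms.
Variables (R : realType) (p : nat) (hp : (3 <= p)%N).
Implicit Types (M N V W : 'M[R]_2) (z : option R) (x y : R) (Q : bqform R).
Local Notation Gam := (@inGamma R p).
Local Notation s := (@che R p).
Local Notation F := (@Phi_ext R p).
Local Notation Phi := (@Phi R p).

Definition mform M : bqform R := (ec M, ed M - ea M, - eb M).

(* The sign condition singles out the root [alphaQ]; both conditions are
   invariant under changes of variable of determinant 1. *)
Definition isroot Q x :=
  fA Q * x ^+ 2 + fB Q * x + fC Q = 0 /\ 0 < 2 * fA Q * x + fB Q.

Lemma isroot_disc Q x : isroot Q x -> disc Q = (2 * fA Q * x + fB Q) ^+ 2.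
Proof.
move=> [h _]; rewrite /disc.
have -> : fC Q = - (fA Q * x ^+ 2 + fB Q * x) by lra.
ring.
Qed.

Lemma isroot_alpha Q x : fA Q != 0 -> isroot Q x -> alphaQ Q = x.
Proof.
move=> h hr; rewrite /alphaQ (isroot_disc hr) sqrtr_sqr ger0_norm; last by case: hr => _ /ltW.
by field.
Qed.

Lemma alpha_isroot Q : fA Q != 0 -> 0 < disc Q -> isroot Q (alphaQ Q).
Proof.
move=> h d0.
have e : 2 * fA Q * alphaQ Q + fB Q = Num.sqrt (disc Q).
  by rewrite /alphaQ; field.
split; last by rewrite e sqrtr_gt0.
have := sqr_sqrtr (ltW d0); rewrite -e /disc => h2.
apply: (mulfI h); rewrite mulr0; lra.
Qed.

(** The values of the two forms differ by the factor (ec V y + ed V)^2, and the derivative at the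
    root is unchanged because [det2 V = 1]. *)
Lemma isroot_act Q V x y : det2 V = 1 -> lft V (Some y) = Some x ->
  isroot Q x -> isroot (form_act Q V) y.
Proof.
rewrite /det2 /= => hV; case: eqVneq => // hk [hx] [h1 h2].
have hn : ea V * y + eb V = x * (ec V * y + ed V) by rewrite -hx divfK.
have hC : fC Q = - (fA Q * x ^+ 2 + fB Q * x) by lra.
set k := ec V * y + ed V in hk hn hx.
rewrite /isroot /form_act /fA /fB /fC /=; rewrite -/(fA Q) -/(fB Q) -/(fC Q).
split.
  transitivity (fA Q * (ea V * y + eb V) ^+ 2 + fB Q * (ea V * y + eb V) * k
    + fC Q * k ^+ 2); first by rewrite /k; ring.
  by rewrite hn hC; ring.
suff -> : 2 * (fA Q * ea V ^+ 2 + fB Q * ea V * ec V + fC Q * ec V ^+ 2) * y +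
  (2 * fA Q * ea V * eb V + fB Q * (ea V * ed V + eb V * ec V) +
   2 * fC Q * ec V * ed V) = 2 * fA Q * x + fB Q by [].
transitivity (ea V * (2 * fA Q * (ea V * y + eb V) + fB Q * k)
  + ec V * (fB Q * (ea V * y + eb V) + 2 * fC Q * k)); first by rewrite /k; ring.
rewrite hn hC.
transitivity ((ea V * k - ec V * (x * k)) * (2 * fA Q * x + fB Q)); first by ring.
rewrite -hn /k.
have -> : ea V * (ec V * y + ed V) - ec V * (ea V * y + eb V) = 1 by rewrite -hV; ring.
by rewrite mul1r.
Qed.

Lemma form_actM Q V W : form_act (form_act Q V) W = form_act Q (V * W).
Proof.
rewrite /form_act /fA /fB /fC /= !mx2s; congr (_, _, _); ring.
Qed.

Lemma form_act1 Q : form_act Q 1 = Q.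
Proof.
case: Q => [[A B] C]; rewrite /form_act /fA /fB /fC /= !mx2s; congr (_, _, _); ring.
Qed.

Lemma disc_act Q V : det2 V = 1 -> disc (form_act Q V) = disc Q.
Proof.
move=> h; rewrite -[RHS]mul1r -(expr1n _ 2) -h.
by rewrite /disc /form_act /fA /fB /fC /det2 /=; ring.
Qed.

Lemma mform_conj M V : det2 V = 1 -> mform (V^-1 * M * V) = form_act (mform M) V.
Proof.
move=> h; rewrite inv2E // /mform /form_act /adj2 /fA /fB /fC /= !mx2s.
by congr (_, _, _); ring.
Qed.

Lemma disc_mform M : det2 M = 1 -> disc (mform M) = trace2 M ^+ 2 - 4.
Proof.
by rewrite /disc /mform /fA /fB /fC /trace2 /det2 /= => h; lra.
Qed.

Lemma fixesP M x : fixes M x -> ec M * x ^+ 2 + (ed M - ea M) * x - eb M = 0.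
Proof.
rewrite /fixes /=; case: eqVneq => // hn [] /(canRL (divfK hn)) h.
by rewrite mulrDr in h; lra.
Qed.

(** Cayley-Hamilton. Hence the forms [mform] of all stabilizer elements are multiples of that of a
    generator. *)
Lemma expz_lin M (k : int) : det2 M = 1 -> exists u v : R, M ^ k = u *: M + v%:M.
Proof.
move=> h.
have hX (n : nat) : exists u v : R, M ^+ n = u *: M + v%:M.
  elim: n => [|n [u [v IH]]].
    by exists 0, 1; apply: mx2P; rewrite expr0 !mx2s; ring.
  exists (u * trace2 M + v), (- u); rewrite exprS IH.
  have hu : u * (ea M * ed M - eb M * ec M) = u by rewrite -/(det2 M) h mulr1.
  by apply: mx2P; rewrite !mx2s /trace2; lra.
case: k => n; first exact: hX.
have [u [v e]] := hX n.+1; rewrite NegzE -exprnN -exprVn exprVn e inv2E; last first.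
  rewrite -e; elim: (n.+1) => [|m IH]; first by rewrite expr0 det2_1.
  by rewrite exprS det2M h IH mulr1.
exists (- u), (u * trace2 M + v).
by rewrite /adj2; apply: mx2P; rewrite !mx2s /trace2; ring.
Qed.

Lemma expz_conj V M (k : int) : det2 V = 1 -> det2 M = 1 ->
  (V^-1 * M * V) ^ k = V^-1 * M ^ k * V.
Proof.
move=> hV hM; have uV := unit2 hV; have uM := unit2 hM.
have hX (n : nat) : (V^-1 * M * V) ^+ n = V^-1 * M ^+ n * V.
  elim: n => [|n IH]; first by rewrite !expr0 mulr1 mulVr.
  by rewrite !exprS IH -!mulrA mulVKr.
case: k => n; first exact: hX.
have uX : M ^+ n.+1 \is a GRing.unit by exact: unitrX.
have uVi : V^-1 \is a GRing.unit by rewrite unitrV.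
have uVX : V^-1 * M ^+ n.+1 \is a GRing.unit by rewrite unitrMr.
by rewrite NegzE -!exprnN hX (invrM uVX uV) (invrM uVi uX) invrK mulrA.
Qed.

(** Names the root and the generator behind a hyperbolic form; [isroot] replaces the square root
    formula because it is transported by [form_act]. *)
Definition hyp_data Q x M :=
  [/\ gen_stab p M x, 4 < trace2 M ^+ 2, Q = mform M & isroot Q x].

Lemma hyp_noncusp N z k : Gam N -> lft N z = z -> 4 < trace2 N ^+ 2 -> iter k F z <> Some 0.
Proof.
by move=> gN fN h /(cusp_not_hyperbolic hp gN fN) e; rewrite e ltxx in h.
Qed.

Lemma hyp_ec M : Gam M -> 4 < trace2 M ^+ 2 -> ec M != 0.
Proof.
move=> gM h; apply/eqP => e; apply: (@hyp_noncusp M None 1 gM) => //.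
  by rewrite /= e eqxx.
exact: lftT_None.
Qed.

Lemma hyperbolic_formP Q : hyperbolic_form p Q <-> exists x M, hyp_data Q x M.
Proof.
split=> [[x [M [_ gs h4 hx hQ]]]|[x [M [gs h4 hQ hr]]]]; exists x, M.
  have [gM fM _] := gs; have c0 := hyp_ec gM h4.
  have dM := Gam_det gM.
  split=> //; rewrite hQ -/(mform M).
  have -> : x = alphaQ (mform M).
    by rewrite hx /alphaQ disc_mform // /mform /fA /fB /= opprB.
  by apply: alpha_isroot => //; rewrite disc_mform // subr_gt0.
have [gM fM _] := gs; have c0 := hyp_ec gM h4; have dM := Gam_det gM.
split=> //.
  exists M => //; split=> //; rewrite tr2 -(ltr_pXn2r (ltn0Sn 1)) ?nnegrE //.
  by rewrite real_normK ?num_real // expr2 -natrM.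
rewrite -(isroot_alpha _ hr) hQ //.
by rewrite /alphaQ disc_mform // /mform /fA /fB /= opprB.
Qed.

Lemma hyp_act Q x M V : hyp_data Q x M -> Gam V -> exists y,
  lft V (Some y) = Some x /\ hyp_data (form_act Q V) y (V^-1 * M * V).
Proof.
move=> [[gM fM cyc] h4 hQ hr] gV; have dV := Gam_det gV; have dM := Gam_det gM.
have uV := unit2 dV; have gVi := Gam_inv gV; have dVi := Gam_det gVi.
have gM' : Gam (V^-1 * M * V) by do 2!apply: GamM => //.
have h4' : 4 < trace2 (V^-1 * M * V) ^+ 2.
  by rewrite -{2}[V]invrK trace2_conj.
have fM' : lft (V^-1 * M * V) (lft V^-1 (Some x)) = lft V^-1 (Some x).
  by rewrite -lftM ?(Gam_det gM') // mulrK // lftM // fM.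
(* V^-1 x is not oo, by [hyp_ec] for the conjugated matrix. *)
case e : (lft V^-1 (Some x)) fM' => [y|] fM'; last first.
  have := hyp_ec gM' h4'; move: fM' => /=; case: eqVneq => //.
have ey : lft V (Some y) = Some x by rewrite -e lftVK.
exists y; split=> //; split=> //; last 2 first.
- by rewrite hQ mform_conj.
- exact: isroot_act hr.
split=> // N gN fN.
have gN' : Gam (V * N * V^-1) by do 2!apply: GamM => //.
have fN' : fixes (V * N * V^-1) x.
  rewrite /fixes -ey -lftM ?(Gam_det gN') // mulrVK // lftM ?(Gam_det gN) //.
  by rewrite fN.
have [k hk] := cyc _ gN' fN'; exists k; rewrite expz_conj //.
have -> : N = V^-1 * (V * N * V^-1) * V by rewrite !mulrA mulrVK // mulVr // mul1r.
by case: hk => ->; [left|right]; rewrite // mulrN mulNr.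
Qed.

Lemma stab_lin M N x : gen_stab p M x -> Gam N -> fixes N x ->
  exists u v : R, N = u *: M + v%:M.
Proof.
move=> [gM _ cyc] gN fN; have [k hk] := cyc _ gN fN.
have [u [v e]] := expz_lin k (Gam_det gM).
case: hk => ->; rewrite e; first by exists u, v.
by exists (- u), (- v); apply: mx2P; rewrite !mx2s; ring.
Qed.

Lemma simple_root_gt0 Q x : isroot Q x -> Gp_simple Q -> 0 < x.
Proof.
move=> [h1 h2] [A0 C0]; rewrite ltNge; apply/negP => x0.
have := mulr_le0_ge0 x0 (ltW h2); have := mulr_ge0 (ltW A0) (sqr_ge0 x); nra.
Qed.

Lemma root_factor Q x u v : isroot Q x ->
  fA Q * u ^+ 2 + fB Q * u * v + fC Q * v ^+ 2 =
  (u - x * v) * (fA Q * u + (fA Q * x + fB Q) * v).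
Proof.
move=> [h _]; have -> : fC Q = - (fA Q * x ^+ 2 + fB Q * x) by lra.
ring.
Qed.

(** Generalizes [che_cassini], the case k = 1, and so compares ratios of consecutive values at any
    distance. *)
Lemma che_ratio a k : s a.+1 * s (a + k) - s (a + k).+1 * s a = s k.
Proof.
elim: a => [|a IH]; first by rewrite che1 // che0 mul1r mulr0 subr0.
by rewrite -[RHS]IH addSn !(che_rec R hp a) !(che_rec R hp (a + k)); ring.
Qed.

(** The outer coefficients of the new form are Q(s i.+1, s i.+2) and Q(s i, s i.+1). In
    [root_factor] the second factor is positive, and the first changes sign between these pairs
    since x lies strictly inside its interval; the lower endpoint is excluded by [Phi x <> 0]. *)
Lemma simple_step Q x : isroot Q x -> Gp_simple Q -> Phi x <> 0 ->
  Gp_simple (form_act Q (stepmx p (Some x))^-1).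
Proof.
move=> hr hs hPhi; have x0 := simple_root_gt0 hr hs.
have [i ip [ok e]] := idxP hp (ltW x0).
have hsg := stepmx_ge0 hp (ltW x0) ip ok.
have dsg := Gam_det (stepmx_Gam p (Some x)).
have hB : 0 < fA Q * x + fB Q.
  case: hs hr => _ C0 [h _]; rewrite -(pmulr_rgt0 _ x0); lra.
have s0 : 0 < s i.+1 by apply: che_gt0 => //; lia.
have s1 : 0 <= s i by apply: che_ge0 => //; lia.
have s2 : 0 <= s i.+2 by apply: che_ge0.
move: (ok) => /andP [h1 h2]; case: (hs) => A0 C0.
have h1' : s i < x * s i.+1.
  rewrite lt_neqAle h1 andbT; apply/eqP => h3; apply: hPhi.
  have [h _] := Phi_ext_ge0 hp (ltW x0); move: h; rewrite /Phi_ext hsg /= !mx2s.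
  by case: eqVneq => // _ []; rewrite mulNr [s i.+1 * x]mulrC -h3 addNr mul0r => <-.
rewrite inv2E // hsg /Gp_simple /form_act /adj2 {1}/fA {3}/fC /= !mx2s.
have -> : fA Q * (- s i.+1) ^+ 2 + fB Q * - s i.+1 * - s i.+2 + fC Q * (- s i.+2) ^+ 2
  = fA Q * s i.+1 ^+ 2 + fB Q * s i.+1 * s i.+2 + fC Q * s i.+2 ^+ 2 by ring.
have -> : fA Q * (- s i) ^+ 2 + fB Q * - s i * - s i.+1 + fC Q * (- s i.+1) ^+ 2
  = fA Q * s i ^+ 2 + fB Q * s i * s i.+1 + fC Q * s i.+1 ^+ 2 by ring.
rewrite !(root_factor _ _ hr); split.
  apply: mulr_gt0; first by rewrite subr_gt0.
  by apply: ltr_pwDl; [exact: mulr_gt0|apply: mulr_ge0 => //; exact: ltW].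
rewrite nmulr_rlt0; last by rewrite subr_lt0.
by apply: ltr_wpDl; [apply: mulr_ge0 => //; exact: ltW|exact: mulr_gt0].
Qed.

(* A simple form has exactly one simple predecessor: [t |-> Q(1, -t)] changes
   sign once on [0, oo), in exactly one of the intervals cut out by the
   ratios [s i.+2 / s i.+1]. *)
Lemma simple_pred_index Q i j : (i.+2 <= p)%N -> (j.+2 <= p)%N -> Gp_simple Q ->
  Gp_simple (form_act Q (mx2 (- s i.+1) (s i) (s i.+2) (- s i.+1))) ->
  Gp_simple (form_act Q (mx2 (- s j.+1) (s j) (s j.+2) (- s j.+1))) -> i = j.
Proof.
move=> ip jp [A0 C0].
have w a b : (a < b)%N -> (b.+2 <= p)%N ->
    Gp_simple (form_act Q (mx2 (- s a.+1) (s a) (s a.+2) (- s a.+1))) ->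
    Gp_simple (form_act Q (mx2 (- s b.+1) (s b) (s b.+2) (- s b.+1))) -> False.
  move=> ab bp [hA _] [_ hC].
  move: hA hC; rewrite /form_act {1}/fA {4}/fC /= !mx2s => hA hC.
  have u0 : 0 < s a.+1 by apply: che_gt0 => //; lia.
  have v0 : 0 < s a.+2 by apply: che_gt0 => //; lia.
  have u1 : 0 < s b by apply: che_gt0 => //; lia.
  have v1 : 0 < s b.+1 by apply: che_gt0 => //; lia.
  have hr : s b.+1 * s a.+1 <= s a.+2 * s b.
    rewrite -subr_ge0; have := che_ratio a.+1 (b - a.+1); rewrite subnKC // => ->.
    by apply: che_ge0 => //; lia.
  move: (s a.+1) (s a.+2) (s b) (s b.+1) hA hC u0 v0 u1 v1 hr => u v u' v' hA hC u0 v0 u1 v1 hr.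
  (* The combination u' v' Q(u, -v) - u v Q(u', -v') eliminates B and equals -(v u' - v' u) (A u u'
     - C v v'), which is nonpositive. *)
  have n1 := mulr_gt0 (mulr_gt0 u1 v1) hA.
  have n2 : 0 < - (fA Q * u' ^+ 2 + fB Q * u' * - v' + fC Q * (- v') ^+ 2) by rewrite oppr_gt0.
  have n3 := mulr_gt0 (mulr_gt0 u0 v0) n2.
  have n4 : 0 <= (v * u' - v' * u) * (fA Q * u * u' - fC Q * v * v').
    apply: mulr_ge0; first by rewrite subr_ge0.
    rewrite subr_ge0; apply: (@le_trans _ _ 0).
      by rewrite -mulrA; apply: mulr_le0_ge0; rewrite ?mulr_ge0 ?ltW.
    by rewrite !mulr_ge0 // ltW.
  nra.
move=> h1 h2; have [h|h|//] := ltngtP i j; exfalso.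
  exact: (w _ _ h jp h1 h2).
exact: (w _ _ h ip h2 h1).
Qed.

(** A combination u M + v has positive off-diagonal entries, so those of M share one sign; the sign
    condition in [isroot] at x > 0 makes it positive. *)
Lemma periodic_simple Q x M : hyp_data Q x M -> 0 < x ->
  (exists2 r, (0 < r)%N & iter r F (Some x) = Some x) -> Gp_simple Q.
Proof.
move=> [gs h4 hQ [h1 h2]] x0 per.
have [W [[gW fW _] [_ bW cW _] _]] := periodic_gen_stab hp x0 per.
have [u [v e]] := stab_lin gs gW fW.
move: bW cW h1 h2; rewrite e !mx2s hQ /Gp_simple /mform /fA /fB /fC /= => bW cW h1 h2.
have bc : 0 < eb M * ec M.
  by have := mulr_gt0 bW cW; rewrite mulrACA -expr2 pmulr_rgt0 // exprn_even_gt0 //=;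
    apply/eqP => u0; move: bW; rewrite u0 mul0r ltxx.
have c0 : 0 < ec M.
  rewrite ltNge le_eqVlt; apply/negP => /orP [/eqP c0|c0].
    by rewrite c0 mulr0 ltxx in bc.
  have b0 : eb M < 0 by rewrite -(nmulr_lgt0 _ c0).
  have := mulr_gt0 x0 h2; have := mulr_le0_ge0 (ltW c0) (sqr_ge0 x); nra.
by split=> //; rewrite oppr_lt0 -(pmulr_lgt0 _ c0).
Qed.

End Forms.

(** * The cycle formed by the simple roots of one class *)

Section FormClass.
Variables (R : realType) (p : nat) (hp : (3 <= p)%N).
Variables (Q0 : bqform R) (x0 : R) (M0 : 'M[R]_2).
Hypothesis hyp0 : hyp_data p Q0 x0 M0.
Implicit Types (M N V W : 'M[R]_2) (z : option R) (x y : R) (Q : bqform R).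
Local Notation Gam := (@inGamma R p).
Local Notation F := (@Phi_ext R p).
Local Notation Phi := (@Phi R p).

(** Carrying the root along with the form keeps it equivalent to x0 under the group, as merging
    requires. *)
Definition in_class Q x := exists V,
  [/\ Gam V, Q = form_act Q0 V, lft V (Some x) = Some x0 & exists M, hyp_data p Q x M].

Lemma in_class_base : in_class Q0 x0.
Proof.
exists 1; rewrite form_act1 lft1; split=> //; first exact: Gam1.
by exists M0.
Qed.

Lemma in_class_act Q x N : in_class Q x -> Gam N -> exists y,
  lft N (Some y) = Some x /\ in_class (form_act Q N) y.
Proof.
move=> [V [gV -> eV [M hM]]] gN; have [y [ey hy]] := hyp_act hp hM gN.
exists y; split=> //; exists (V * N); split.
- exact: GamM.
- by rewrite form_actM.
- by rewrite lftM ?(Gam_det gV) ?(Gam_det gN) // ey.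
- by exists (N^-1 * M * N).
Qed.

Lemma in_class_isroot Q x : in_class Q x -> isroot Q x.
Proof. by case=> V [_ _ _ [M []]]. Qed.

Lemma in_class_noncusp Q x k : in_class Q x -> iter k F (Some x) <> Some 0.
Proof.
case=> V [_ _ _ [M [[gM fM _] h4 _ _]]]; exact: (hyp_noncusp hp gM fM h4).
Qed.

(** The forms are proportional; equal discriminants give a factor of square 1, and the sign
    condition on the root makes it positive. *)
Lemma in_class_uniq Q Q' x : in_class Q x -> in_class Q' x -> Q = Q'.
Proof.
move=> [V [gV eV _ [M [gs h4 hQ [_ hr]]]]] [V' [gV' eV' _ [M' [gs' h4' hQ' [_ hr']]]]].
have [gM' fM' _] := gs'; have [u [v e]] := stab_lin gs gM' fM'.
have hd : disc Q = disc Q' by rewrite eV eV' !disc_act ?(Gam_det gV) ?(Gam_det gV').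
have d0 : 0 < disc Q.
  by have [gM _ _] := gs; rewrite hQ disc_mform ?(Gam_det gM) // subr_gt0.
have eQ : Q' = (u * fA Q, u * fB Q, u * fC Q).
  by rewrite hQ' e /mform !mx2s hQ /mform /fA /fB /fC /=; congr (_, _, _); ring.
have u0 : 0 < u.
  move: hr'; rewrite eQ {1}/fA {2}/fB /=.
  have -> : 2 * (u * fA Q) * x + u * fB Q = u * (2 * fA Q * x + fB Q) by ring.
  by rewrite pmulr_lgt0.
have u1 : u ^+ 2 = 1.
  apply: (mulIf (lt0r_neq0 d0)); rewrite mul1r [in RHS]hd eQ.
  by rewrite /disc /fA /fB /fC /=; ring.
have {}u1 : u = 1.
  by apply/eqP; rewrite -(eqrXn2 (n := 2)) ?u1 ?expr1n // ltW.
by rewrite eQ u1 !mul1r; case: (Q) => [[]].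
Qed.

Lemma in_class_merge Q Q' x y : in_class Q x -> in_class Q' y ->
  exists m n, iter m F (Some x) = iter n F (Some y).
Proof.
move=> [V [gV _ eV _]] [V' [gV' _ eV' _]].
have gN : Gam (V'^-1 * V) by apply: GamM => //; exact: Gam_inv.
have eN : lft (V'^-1 * V) (Some x) = Some y.
  rewrite lftM ?(Gam_det gV) // ?(Gam_det (Gam_inv gV')) // eV -eV' lftK //.
  exact: Gam_det gV'.
have [m [n h]] := merges_Gam hp (Some x) gN.
by exists m, n; rewrite (merges_iter gN h) eN.
Qed.

Definition simple_pt x := exists2 Q, in_class Q x & Gp_simple Q.

Lemma ZA_simple_pt x : ZA (fclass p Q0) x <-> simple_pt x.
Proof.
split=> [[Q [V gV eQ] [hs ->]]|[Q hm hs]].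
  have [y [_ hy]] := in_class_act in_class_base gV; rewrite -eQ in hy.
  rewrite (isroot_alpha _ (in_class_isroot hy)); first by exists Q.
  by rewrite gt_eqF //; case: hs.
exists Q; first by case: hm => V [gV eQ _ _]; exists V.
split=> //; rewrite (isroot_alpha _ (in_class_isroot hm)) //.
by rewrite gt_eqF //; case: hs.
Qed.

Lemma simple_pt_gt0 x : simple_pt x -> 0 < x.
Proof. by case=> Q hm hs; apply: simple_root_gt0 hs; exact: in_class_isroot. Qed.

Lemma in_class_Phi Q x : in_class Q x -> 0 < x ->
  in_class (form_act Q (stepmx p (Some x))^-1) (Phi x).
Proof.
move=> hm xp; have gs := stepmx_Gam p (Some x); have ds := Gam_det gs.
have [y [ey hy]] := in_class_act hm (Gam_inv gs).
have [e _] := Phi_ext_ge0 hp (ltW xp).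
suff -> : Phi x = y by [].
by move: e; rewrite /Phi_ext -{2}ey lftVK // => -[].
Qed.

Lemma simple_Phi Q x : in_class Q x -> Gp_simple Q ->
  Gp_simple (form_act Q (stepmx p (Some x))^-1).
Proof.
move=> hm hs; have xp : 0 < x by apply: simple_pt_gt0; exists Q.
apply: simple_step => //; first exact: in_class_isroot.
by move=> h; apply: (@in_class_noncusp _ _ 0 (in_class_Phi hm xp)); rewrite h.
Qed.

Lemma simple_pt_Phi x : simple_pt x -> simple_pt (Phi x).
Proof.
move=> [Q hm hs]; exists (form_act Q (stepmx p (Some x))^-1); last exact: simple_Phi.
by apply: in_class_Phi => //; apply: simple_pt_gt0; exists Q.
Qed.

Lemma simple_pt_iter k x : simple_pt x -> simple_pt (iter k Phi x).
Proof. by move=> h; elim: k => //= k; exact: simple_pt_Phi. Qed.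

(** The common image determines one form, which has a single simple predecessor. So both steps use
    the same matrix, which is invertible. *)
Lemma Phi_inj x y : simple_pt x -> simple_pt y -> Phi x = Phi y -> x = y.
Proof.
move=> sx sy e; have xp := simple_pt_gt0 sx; have yp := simple_pt_gt0 sy.
case: sx sy => [Q hm hs] [Q' hm' hs'].
have eQ : form_act Q (stepmx p (Some x))^-1 = form_act Q' (stepmx p (Some y))^-1.
  by apply: (@in_class_uniq _ _ (Phi x)); [exact: in_class_Phi|rewrite e; exact: in_class_Phi].
have hs1 := simple_Phi hm hs.
have ux := unit2 (Gam_det (stepmx_Gam p (Some x))).
have uy := unit2 (Gam_det (stepmx_Gam p (Some y))).
have back : form_act (form_act Q (stepmx p (Some x))^-1) (stepmx p (Some x)) = Q.
  by rewrite form_actM mulVr // form_act1.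
have back' : form_act (form_act Q (stepmx p (Some x))^-1) (stepmx p (Some y)) = Q'.
  by rewrite eQ form_actM mulVr // form_act1.
have [i ip [oki _]] := idxP hp (ltW xp); have [j jp [okj _]] := idxP hp (ltW yp).
have ex := stepmx_ge0 hp (ltW xp) ip oki; have ey := stepmx_ge0 hp (ltW yp) jp okj.
have ij : i = j.
  apply: (simple_pred_index hp ip jp hs1); first by rewrite -ex back.
  by rewrite -ey back'.
have es : stepmx p (Some x) = stepmx p (Some y) by rewrite ex ey ij.
have [fx _] := Phi_ext_ge0 hp (ltW xp); have [fy _] := Phi_ext_ge0 hp (ltW yp).
have ds := Gam_det (stepmx_Gam p (Some x)).
suff: Some x = Some y by case.
rewrite -(lftK (Some x) ds) -(lftK (Some y) ds) {4}es.
by rewrite -/(Phi_ext p (Some x)) -/(Phi_ext p (Some y)) fx fy e.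
Qed.

Lemma simple_pt_periodic x : simple_pt x -> exists2 r, (0 < r)%N & iter r Phi x = x.
Proof.
move=> sx; have xp := simple_pt_gt0 sx.
have [n [r [r0 h]]] : exists n r, (0 < r)%N /\ iter r F (iter n F (Some x)) = iter n F (Some x).
  case: (sx) => Q [V [_ _ _ [M [[gM fM _] h4 _ _]]]] _.
  exact: (hyperbolic_ev_periodic hp gM fM h4).
exists r => //; move: h; rewrite -iterD addnC.
have [-> _] := iter_Phi_ext_ge0 hp (n + r) (ltW xp).
have [-> _] := iter_Phi_ext_ge0 hp n (ltW xp).
case; rewrite iterD; elim: n => //= n IH h; apply: IH.
(* Injectivity cancels the preperiodic steps one by one. *)
by apply: Phi_inj h; do ?apply: simple_pt_iter.
Qed.

Lemma simple_pt_orbit x y : simple_pt x -> (simple_pt y <-> exists k, y = iter k Phi x).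
Proof.
move=> sx; split=> [sy|[k ->]]; last exact: simple_pt_iter.
have xp := simple_pt_gt0 sx; have yp := simple_pt_gt0 sy.
have [Q hm _] := sx; have [Q' hm' _] := sy.
have [m [n]] := in_class_merge hm hm'.
have [-> _] := iter_Phi_ext_ge0 hp m (ltW xp).
have [-> _] := iter_Phi_ext_ge0 hp n (ltW yp).
case=> e; have [r r0 hr] := simple_pt_periodic sy.
(* After merging, n * r - n further steps complete n periods of y. *)
exists (n * r - n + m)%N; rewrite iterD e -iterD subnK ?leq_pmulr //.
by elim: (n) => //= q IH; rewrite mulSn iterD -IH hr.
Qed.

(** From the first step on the orbit stays in [0, oo), and a periodic point recurs there. *)
Lemma periodic_gt0 r z : (0 < r)%N -> iter r F z = z ->
  (forall k, iter k F z <> Some 0) -> exists2 x, z = Some x & 0 < x.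
Proof.
case: r => // r _ per ncusp.
have [y y0 ey] : exists2 y, 0 <= y & F z = Some y.
  case: z per ncusp => [x|] _ ncusp; last first.
    by case: (ncusp 1%N); exact: lftT_None.
  have [h|h] := ltP x 0.
    by exists (- x^-1); rewrite ?oppr_ge0 ?invr_le0 ?ltW // /Phi_ext /= h -lftT // lt_eqF.
  by have [e h'] := Phi_ext_ge0 hp h; exists (Phi x).
move: per; rewrite iterSr ey; have [-> h] := iter_Phi_ext_ge0 hp r y0 => ez.
exists (iter r Phi y) => //; rewrite lt_neqAle h andbT; apply/eqP => e.
by case: (ncusp 0%N); rewrite -ez -e.
Qed.

(** The cocycle carries Q0 to a form whose root is a periodic point on the orbit of x0; such a form
    is simple. *)
Lemma simple_pt_ex : exists x, simple_pt x.
Proof.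
have [[gM fM _] h4 _ _] := hyp0.
have [n [r [r0 per]]] := hyperbolic_ev_periodic hp gM fM h4.
have nc k : iter k F (iter n F (Some x0)) <> Some 0.
  by rewrite -iterD; exact: in_class_noncusp in_class_base.
have [b eb b0] := periodic_gt0 r0 per nc.
have gC := cocycle_Gam p n (Some x0); have dC := Gam_det gC.
have [y [ey hy]] := in_class_act in_class_base (Gam_inv gC).
have yb : y = b.
  suff: Some y = Some b by case.
  by rewrite -eb -cocycle_lft -{2}ey lftVK.
rewrite yb in hy; exists b; eexists; first exact: hy.
case: hy => V [_ _ _ [M hM]]; apply: (periodic_simple hp hM b0).
by exists r => //; rewrite -eb.
Qed.

End FormClass.

(** * Finite orbits and classes of hyperbolic forms *)

Lemma orbit_mod (T : Type) (f : T -> T) (x : T) n : (0 < n)%N -> iter n f x = x ->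
  [set y | exists2 k, (k < n)%N & y = iter k f x] = [set y | exists k, y = iter k f x].
Proof.
move=> n0 h; apply/seteqP; split=> y /= [k]; first by move=> _ ->; exists k.
move=> ->; exists (k %% n)%N; first by rewrite ltn_mod.
rewrite {1}(divn_eq k n) addnC iterD; congr iter.
by elim: (k %/ n)%N => //= q IH; rewrite mulSn iterD IH.
Qed.

Lemma ZA_orbit (R : realType) (p : nat) (hp : (3 <= p)%N) (Q0 : bqform R) x0 M0 x :
  hyp_data p Q0 x0 M0 -> ZA (fclass p Q0) x ->
  ZA (fclass p Q0) = [set y | exists k, y = iter k (Phi p) x].
Proof.
move=> h /(ZA_simple_pt hp h) sx; apply/seteqP; split=> y /=.
  by move=> /(ZA_simple_pt hp h); apply (simple_pt_orbit hp y sx).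
by move=> hy; apply/(ZA_simple_pt hp h); apply (simple_pt_orbit hp y sx).
Qed.

Lemma Phi0 (R : realType) (p : nat) : (3 <= p)%N -> Phi p (0 : R) = 0.
Proof. by move=> hp; have [] := Phi_ext_ge0 hp (lexx (0 : R)); rewrite Phi_ext0 // => -[]. Qed.

Theorem theorem6p4 (R : realType) (p : nat) (hp : (3 <= p)%N) (Z : set R) :
  finite_orbit p Z <->
  (Z = [set 0] \/
   exists Q0 : bqform R,
     [/\ is_BQF p Q0,
         (forall Q, fclass p Q0 Q -> hyperbolic_form p Q) &
         Z = ZA (fclass p Q0)]).
Proof.
have it0 k : iter k (Phi p) (0 : R) = 0 by elim: k => //= k ->; exact: Phi0.
split=> [[x [n [x_ge0 [n0 [per ->]]]]]|[->|[Q0 [_ hc ->]]]].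
- rewrite orbit_mod //; have [->|xn] := eqVneq x 0; [left|right].
    apply/seteqP; split=> y /= => [[k ->]|->]; first exact: it0.
    by exists 0%N.
  have xp : 0 < x by rewrite lt0r xn.
  have perF : exists2 r, (0 < r)%N & iter r (@Phi_ext R p) (Some x) = Some x.
    by exists n => //; have [-> _] := iter_Phi_ext_ge0 hp n x_ge0; rewrite per.
  have [W [gs [aW bW cW dW] h4]] := periodic_gen_stab hp xp perF.
  have [gW fW _] := gs; have fx := fixesP fW.
  have hr : isroot (mform W) x.
    rewrite /isroot /mform /fA /fB /fC /=; split=> //.
    (* By the root equation x (2 A x + B) = A x^2 - C, a sum of positive terms. *)
    rewrite -(pmulr_rgt0 _ xp); have := mulr_gt0 cW (exprn_gt0 2 xp); nra.
  have hyp0 : hyp_data p (mform W) x W by [].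
  have [Za Zb Zc Zd] := Gam_Zlam gW.
  exists (mform W); split.
  + split; rewrite ?disc_mform ?(Gam_det gW) ?subr_gt0 //; rewrite /mform /fA /fB /fC /=.
    * by apply: ZlamD => //; exact: ZlamN.
    * exact: ZlamN.
  + move=> Q [V gV ->]; apply/(hyperbolic_formP hp).
    by have [y [_ hy]] := hyp_act hp hyp0 gV; exists y; eexists; exact: hy.
  + rewrite (ZA_orbit hp hyp0 (x := x)) //; apply/(ZA_simple_pt hp hyp0).
    exists (mform W); first exact: in_class_base hyp0.
    by split; rewrite /mform /fA /fC //= oppr_lt0.
- exists 0, 1%N; split=> //; split=> //; split; first exact: it0.
  rewrite orbit_mod //; apply/seteqP; split=> y /= => [->|[k ->]]; first by exists 0%N.
  exact: it0.
- have /(hyperbolic_formP hp) [x0 [M0 hyp0]] : hyperbolic_form p Q0.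
    by apply: hc; exists 1; [exact: Gam1|rewrite form_act1].
  have [x sx] := simple_pt_ex hp hyp0.
  have [r r0 per] := simple_pt_periodic hp sx.
  exists x, r; split; first by rewrite ltW //; exact: simple_pt_gt0 sx.
  split=> //; split=> //; rewrite orbit_mod //.
  by apply: (ZA_orbit hp hyp0); apply/(ZA_simple_pt hp hyp0).
Qed.
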